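(* Let $t_0, r\in\mathbb{R}$ with $r>0$ and let $I:=[t_0,t_0+r]$. Suppose that $f:I\times\mathbb{R}\to\mathbb{R}$ is a continuous function satisfying the Lipschitz condition $$|f(t,y_1)-f(t,y_2)|\leq L|y_1-y_2|$$ for all $t\in I$, all $y_1,y_2\in\mathbb{R}$ and some $L>0$. Let $\varepsilon\geq 0$ and let $\eta$ be an arbitrary fixed real number with $\eta>L$. If a continuous function $y:I\to\mathbb{R}$ satisfies $$\left|y(t)-\int_{t_0}^{t}f(s,y(s))\,ds\right|\leq\varepsilon$$ for all $t\in I$, then there exists a unique solution $y_0:I\to\mathbb{R}$ of the Volterra integral equation $$y_0(t)=\int_{t_0}^{t}f(s,y_0(s))\,ds,\qquad t\in I,$$ satisfying $$|y(t)-y_0(t)|\leq\frac{\varepsilon\,e^{\eta r}}{1-L/\eta}$$ for all $t\in I$.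
   Context: A solution of the Volterra integral equation on $I$ is a continuous function $y_0:I\to\mathbb{R}$ satisfying the equation for every $t\in I$. *)

(* Defs.v *)
From Stdlib Require Import Reals.
From Coquelicot Require Import Coquelicot.
Open Scope R_scope.

Definition Itv (t0 r : R) (t : R) : Prop := t0 <= t <= t0 + r.

(* Functions on Itv t0 r (resp. its product with R) are represented by functions on R (resp. R * R)
   whose values outside are irrelevant: continuity is relative to the domain,
   and RInt over [t0, t] only sees the values of the integrand on ]t0, t[.
   RInt is total, but for continuous f and y the integrand is continuous on
   [t0, t], so it is the genuine Riemann integral. *)
Definition volterra_solution (t0 r : R) (f : R * R -> R) (y : R -> R) : Prop :=
  continuous_on (Itv t0 r) y /\
  forall t : R, Itv t0 r t -> y t = RInt (fun s => f (s, y s)) t0 t.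

(* Main.v *)
Require Import Defs.
From Stdlib Require Import Reals.
From Coquelicot Require Import Coquelicot.
From Stdlib Require Import Lra Lia.
Open Scope R_scope.

(** The integral operator of the equation is a contraction with factor
    [q = L / eta < 1] for the weighted sup norm with weight
    [exp (- eta * (t - t0))]. Iterating it from [y], consecutive iterates differ by at
    most [eps * q ^ n * exp (eta * (t - t0))], so they converge uniformly to a
    solution whose distance to [y] is bounded by the geometric sum. Two solutions
    within bounded distance of each other coincide by iterating the contraction. *)

(** * Geometric bounds and limits of real sequences *)

Lemma geometric_null (A q : R) : 0 <= q < 1 -> is_lim_seq (fun n => A * q ^ n) 0.
Proof.
intros hq.
replace (Finite 0) with (Rbar_mult A 0) by (simpl; f_equal; ring).
apply is_lim_seq_scal_l, is_lim_seq_geom.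
now rewrite Rabs_pos_eq.
Qed.

Lemma geometric_bound_eq0 (x A q : R) :
  0 <= q < 1 -> (forall n, Rabs x <= A * q ^ n) -> x = 0.
Proof.
intros hq H.
assert (Hle : Rbar_le (Rabs x) 0).
{ apply (is_lim_seq_le (fun _ => Rabs x) (fun n => A * q ^ n)); auto.
  - apply is_lim_seq_const.
  - now apply geometric_null. }
simpl in Hle.
destruct (Req_dec x 0) as [|hx]; auto.
apply Rabs_pos_lt in hx; lra.
Qed.

(** The increments are dominated by a geometric series, so the sequence is Cauchy. Summing them from
    [n] to [n + k] and letting [k] tend to infinity bounds the distance to the limit by the tail of
    that series. *)
Lemma geometric_increments_limit (a : nat -> R) (B q : R) :
  0 <= q < 1 -> (forall n, Rabs (a (S n) - a n) <= B * q ^ n) ->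
  forall n, Rabs (a n - real (Lim_seq a)) <= B * q ^ n / (1 - q).
Proof.
intros hq Ha.
assert (hB : 0 <= B).
{ generalize (Ha 0%nat) (Rabs_pos (a 1%nat - a 0%nat)); simpl; lra. }
assert (hBq : forall n, 0 <= B * q ^ n).
{ intro n; apply Rmult_le_pos; auto; apply pow_le; lra. }
(* The exact partial sum of the geometric series is kept here, so that the induction on [k] closes;
   the factor [1 - q ^ k <= 1] is dropped afterwards. *)
assert (Hk : forall n k, Rabs (a (n + k)%nat - a n) <= B * q ^ n * (1 - q ^ k) / (1 - q)).
{ intros n k; induction k as [|k IH].
  - rewrite Nat.add_0_r, Rminus_diag, Rabs_R0; simpl.
    right; field; lra.
  - rewrite Nat.add_succ_r.
    replace (a (S (n + k)) - a n) with ((a (S (n + k)) - a (n + k)%nat) + (a (n + k)%nat - a n)) by ring.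
    eapply Rle_trans; [apply Rabs_triang|].
    eapply Rle_trans; [apply Rplus_le_compat; [apply Ha | apply IH]|].
    right; rewrite pow_add; simpl; field; lra. }
assert (Hk' : forall n k, Rabs (a (n + k)%nat - a n) <= B * q ^ n / (1 - q)).
{ intros n k; eapply Rle_trans; [apply Hk|].
  apply Rmult_le_compat_r; [left; apply Rinv_0_lt_compat; lra|].
  assert (0 <= q ^ k) by (apply pow_le; lra).
  generalize (hBq n); nra. }
assert (Hcv : ex_finite_lim_seq a).
{ apply ex_lim_seq_cauchy_corr.
  intros e.
  assert (Hl := geometric_null (B / (1 - q)) q hq).
  (* Choose [N] with tail bound below [e / 2]: all later terms are then that close to [a N]. *)
  apply is_lim_seq_spec in Hl.
  destruct (Hl (pos_div_2 e)) as [N HN].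
  exists N; intros n m hn hm.
  specialize (HN N (Nat.le_refl N)); simpl in HN.
  assert (HNn := Hk' N (n - N)%nat).
  assert (HNm := Hk' N (m - N)%nat).
  replace (N + (n - N))%nat with n in HNn by lia.
  replace (N + (m - N))%nat with m in HNm by lia.
  replace (B * q ^ N / (1 - q)) with (B / (1 - q) * q ^ N - 0) in HNn, HNm by (field; lra).
  apply Rabs_def2 in HN.
  replace (a n - a m) with ((a n - a N) - (a m - a N)) by ring.
  eapply Rle_lt_trans; [apply Rabs_triang|].
  rewrite Rabs_Ropp; lra. }
intros n.
apply Lim_seq_correct' in Hcv.
rewrite Rabs_minus_sym.
assert (Hl : is_lim_seq (fun k => Rabs (a (n + k)%nat - a n)) (Rabs (Lim_seq a - a n))).
{ apply (is_lim_seq_abs _ (Finite (real (Lim_seq a) - a n))).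
  apply is_lim_seq_minus'; [|apply is_lim_seq_const].
  apply is_lim_seq_ext with (fun k => a (k + n)%nat).
  - intro k; f_equal; lia.
  - now apply is_lim_seq_incr_n. }
exact (is_lim_seq_le _ _ _ _ (Hk' n) Hl (is_lim_seq_const _)).
Qed.

(** * Continuity relative to a subset *)

Lemma continuous_on_uniform_limit {U : UniformSpace} (D : U -> Prop) (h : U -> R) :
  (forall e, 0 < e -> exists g : U -> R,
     continuous_on D g /\ forall x, D x -> Rabs (h x - g x) <= e) ->
  continuous_on D h.
Proof.
intros H x hx.
apply filterlim_locally; intros e.
(* Error budget: [e / 4] for replacing [h] by [g] at each of the two points, and strictly less than
   [e / 2] for the variation of [g]. *)
destruct (H (e / 4)) as [g [hg hhg]]; [destruct e; simpl; lra|].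
assert (Hg := proj1 (filterlim_locally _ _) (hg x hx) (pos_div_2 e)).
unfold within in *.
revert Hg; apply filter_imp; intros z Hz hz.
specialize (Hz hz).
assert (H1 := hhg x hx).
assert (H2 := hhg z hz).
apply Rabs_def1; apply Rabs_def2 in Hz; apply Rabs_le_between in H1; apply Rabs_le_between in H2;
  unfold minus, plus, opp in *; simpl in *; destruct e as [e he]; simpl in *; lra.
Qed.

(** Since [h] takes all its values in [D], restricting neighbourhoods to [D] costs nothing after
    pulling back along [h], and relative continuity becomes ordinary continuity. *)
Lemma continuous_on_comp {U V W : UniformSpace} (D : V -> Prop) (g : V -> W) (h : U -> V) (x : U) :
  continuous_on D g -> (forall u, D (h u)) -> continuous h x ->
  continuous (fun u => g (h u)) x.
Proof.
intros hg hD hh.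
apply (filterlim_comp _ _ _ h g (locally x) (within D (locally (h x)))); [|apply hg, hD].
intros P HP.
specialize (hh _ HP).
unfold within, filtermap in *.
revert hh; apply filter_imp; intros u Hu.
now apply Hu.
Qed.

Lemma continuous_everywhere_on {U V : UniformSpace} (D : U -> Prop) (g : U -> V) :
  (forall x, continuous g x) -> continuous_on D g.
Proof.
intros hg x _.
eapply filterlim_filter_le_1; [|apply hg].
apply filter_le_within.
Qed.

(** For [0 < r] this is the retraction of the line onto the interval. Precomposing with it extends a
    function continuous on the interval to one continuous everywhere, without changing its integrals
    inside the interval. *)
Definition clamp (t0 r t : R) : R := Rmax t0 (Rmin t (t0 + r)).

Lemma clamp_in (t0 r t : R) : 0 < r -> Itv t0 r (clamp t0 r t).
Proof. unfold Itv, clamp, Rmax, Rmin; intros; repeat destruct Rle_dec; lra. Qed.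

Lemma clamp_id (t0 r t : R) : Itv t0 r t -> clamp t0 r t = t.
Proof. unfold Itv, clamp, Rmax, Rmin; intros; repeat destruct Rle_dec; lra. Qed.

Lemma continuous_clamp (t0 r t : R) : continuous (clamp t0 r) t.
Proof.
apply filterlim_locally; intros e; exists e; intros s hs.
apply Rabs_def2 in hs; apply Rabs_def1; destruct e as [e he];
unfold minus, plus, opp in *; simpl in *;
unfold clamp, Rmax, Rmin; repeat destruct Rle_dec; lra.
Qed.

(** * The integral operator and its contraction property *)

Definition picard (t0 : R) (f : R * R -> R) (v : R -> R) (t : R) : R :=
  RInt (fun s => f (s, v s)) t0 t.

Section Picard.

Variables (t0 r : R) (f : R * R -> R).
Hypothesis hr : 0 < r.
Hypothesis hf : continuous_on (fun p : R * R => Itv t0 r (fst p)) f.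

Lemma continuous_clamped_integrand (v : R -> R) (s : R) :
  continuous_on (Itv t0 r) v ->
  continuous (fun s => f (clamp t0 r s, v (clamp t0 r s))) s.
Proof.
intros hv.
apply (continuous_on_comp _ f (fun s => (clamp t0 r s, v (clamp t0 r s))) s hf).
- intro u; now apply clamp_in.
- apply (continuous_comp_2 (clamp t0 r) (fun s => v (clamp t0 r s)) pair).
  + apply continuous_clamp.
  + apply (continuous_on_comp (Itv t0 r)); auto using continuous_clamp, clamp_in.
  (* Uncurried, [pair] is pointwise the identity of the product. *)
  + apply continuous_ext with (fun p : R * R => p).
    * now intros [].
    * apply continuous_id.
Qed.

Lemma ex_RInt_picard (v : R -> R) (t : R) :
  continuous_on (Itv t0 r) v -> Itv t0 r t ->
  ex_RInt (fun s => f (s, v s)) t0 t.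
Proof.
intros hv ht.
apply ex_RInt_ext with (fun s => f (clamp t0 r s, v (clamp t0 r s))).
- unfold Itv in ht; rewrite Rmin_left, Rmax_right by lra; intros s hs.
  rewrite clamp_id; auto; unfold Itv; lra.
- apply (@ex_RInt_continuous R_CompleteNormedModule); intros s _.
  now apply continuous_clamped_integrand.
Qed.

(** On the interval the image agrees with the integral of the clamped integrand, which is
    differentiable on the whole line by the fundamental theorem of calculus. *)
Lemma continuous_on_picard (v : R -> R) :
  continuous_on (Itv t0 r) v -> continuous_on (Itv t0 r) (picard t0 f v).
Proof.
intros hv.
apply continuous_on_ext with (RInt (fun s => f (clamp t0 r s, v (clamp t0 r s))) t0).
- unfold picard; intros t ht; apply RInt_ext.
  unfold Itv in ht; rewrite Rmin_left, Rmax_right by lra; intros s hs.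
  rewrite clamp_id; auto; unfold Itv; lra.
- apply continuous_everywhere_on; intros t.
  apply (@ex_derive_continuous R_AbsRing R_NormedModule).
  eexists.
  apply (is_derive_RInt (fun s => f (clamp t0 r s, v (clamp t0 r s))) _ t0).
  + apply filter_forall; intros u.
    apply (@RInt_correct R_CompleteNormedModule).
    apply (@ex_RInt_continuous R_CompleteNormedModule); intros s _.
    now apply continuous_clamped_integrand.
  + now apply continuous_clamped_integrand.
Qed.

Variables (L eta : R).
Hypothesis hL : 0 < L.
Hypothesis heta : L < eta.
Hypothesis hLip : forall t y1 y2 : R, Itv t0 r t ->
  Rabs (f (t, y1) - f (t, y2)) <= L * Rabs (y1 - y2).

Lemma ratio_bounds : 0 <= L / eta < 1.
Proof.
split.
- apply Rmult_le_pos; [lra | left; apply Rinv_0_lt_compat; lra].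
- apply Rmult_lt_reg_r with eta; [lra|].
  unfold Rdiv; rewrite Rmult_assoc, Rinv_l; lra.
Qed.

(** By the Lipschitz condition the integrands differ by at most [A * L * exp (eta * (s - t0))]. Its
    antiderivative [G] carries the factor [L / eta], and the nonnegative [G t0] is discarded. The
    weight thus gives a contraction whatever the length [r]. *)
Lemma picard_contraction (v w : R -> R) (A : R) :
  continuous_on (Itv t0 r) v -> continuous_on (Itv t0 r) w ->
  (forall s, Itv t0 r s -> Rabs (v s - w s) <= A * exp (eta * (s - t0))) ->
  forall t, Itv t0 r t ->
    Rabs (picard t0 f v t - picard t0 f w t) <= A * (L / eta) * exp (eta * (t - t0)).
Proof.
intros hv hw H t ht.
assert (hA : 0 <= A).
{ assert (h0 : Itv t0 r t0) by (unfold Itv; lra).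
  generalize (H t0 h0) (Rabs_pos (v t0 - w t0)).
  rewrite Rminus_diag, Rmult_0_r, exp_0; lra. }
set (G := fun s => A * (L / eta) * exp (eta * (s - t0))).
assert (HG : is_RInt (fun s => A * L * exp (eta * (s - t0))) t0 t (minus (G t) (G t0))).
{ apply (@is_RInt_derive R_CompleteNormedModule).
  - intros s _; unfold G; auto_derive; [exact I|]; unfold Rminus; field; lra.
  - intros s _; apply (@ex_derive_continuous R_AbsRing R_NormedModule); auto_derive; auto. }
apply Rle_trans with (minus (G t) (G t0)).
- refine (@norm_RInt_le R_NormedModule
    (fun s => minus (f (s, v s)) (f (s, w s))) _ t0 t _ _ (proj1 ht) _ _ HG).
  + intros s hs.
    assert (hs' : Itv t0 r s) by (unfold Itv in *; lra).
    eapply Rle_trans; [apply (hLip s _ _ hs')|].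
    generalize (H s hs'); nra.
  + apply (@is_RInt_minus R_NormedModule);
      apply (@RInt_correct R_CompleteNormedModule); now apply ex_RInt_picard.
- assert (0 <= G t0).
  { apply Rmult_le_pos; [apply Rmult_le_pos; auto; apply ratio_bounds | left; apply exp_pos]. }
  change (G t + - G t0 <= G t); lra.
Qed.

(** The lower bound turns a plain estimate into a weighted one; the upper bound makes a weighted
    estimate uniform in [t]. *)
Lemma exp_weight_le (t : R) : Itv t0 r t -> 1 <= exp (eta * (t - t0)) <= exp (eta * r).
Proof.
intros [h1 h2].
rewrite <- exp_0 at 1.
assert (Hexp : forall a b, a <= b -> exp a <= exp b).
{ intros a b [h|h]; [left; now apply exp_increasing | subst; lra]. }
split; apply Hexp; nra.
Qed.

Lemma picard_fixed_point_unique (z w : R -> R) (A : R) :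
  volterra_solution t0 r f z -> volterra_solution t0 r f w ->
  (forall t, Itv t0 r t -> Rabs (z t - w t) <= A) ->
  forall t, Itv t0 r t -> z t = w t.
Proof.
intros [hz ez] [hw ew] H.
assert (hA : 0 <= A).
{ assert (h0 : Itv t0 r t0) by (unfold Itv; lra).
  generalize (H t0 h0) (Rabs_pos (z t0 - w t0)); lra. }
(* Both functions are fixed by the operator, so each application improves the bound on the same
   difference by a factor [L / eta]. *)
assert (Hn : forall n t, Itv t0 r t ->
  Rabs (z t - w t) <= A * (L / eta) ^ n * exp (eta * (t - t0))).
{ induction n as [|n IH]; intros t ht.
  - simpl; generalize (H t ht) (exp_weight_le t ht); nra.
  - rewrite (ez t ht), (ew t ht).
    eapply Rle_trans; [apply (picard_contraction _ _ _ hz hw IH t ht)|].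
    simpl; right; ring. }
intros t ht.
apply Rminus_diag_uniq.
apply geometric_bound_eq0 with (A * exp (eta * (t - t0))) (L / eta).
- exact ratio_bounds.
- intro n; eapply Rle_trans; [apply (Hn n t ht)|]; right; ring.
Qed.

Lemma picard_fixed_point_near (y : R -> R) (eps : R) :
  continuous_on (Itv t0 r) y ->
  (forall t, Itv t0 r t -> Rabs (y t - picard t0 f y t) <= eps) ->
  exists y0, volterra_solution t0 r f y0 /\
    forall t, Itv t0 r t -> Rabs (y t - y0 t) <= eps * exp (eta * r) / (1 - L / eta).
Proof.
intros hy H.
assert (hq := ratio_bounds).
set (q := L / eta) in *.
set (B := eps * exp (eta * r)).
assert (heps : 0 <= eps).
{ assert (h0 : Itv t0 r t0) by (unfold Itv; lra).
  generalize (H t0 h0) (Rabs_pos (y t0 - picard t0 f y t0)); lra. }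
set (u := fix u n := match n with O => y | S n => picard t0 f (u n) end).
assert (hu : forall n, continuous_on (Itv t0 r) (u n)).
{ induction n; simpl; auto using continuous_on_picard. }
assert (Hinc : forall n t, Itv t0 r t ->
  Rabs (u (S n) t - u n t) <= eps * q ^ n * exp (eta * (t - t0))).
{ induction n as [|n IH]; intros t ht.
  - simpl; rewrite Rabs_minus_sym.
    generalize (H t ht) (exp_weight_le t ht); nra.
  - eapply Rle_trans; [apply (picard_contraction _ _ _ (hu (S n)) (hu n) IH t ht)|].
    simpl; unfold q; right; ring. }
set (y0 := fun t => real (Lim_seq (fun n => u n t))).
(* Replacing the weight by its maximum, absorbed in [B], makes the convergence uniform. *)
assert (Hlim : forall n t, Itv t0 r t -> Rabs (u n t - y0 t) <= B * q ^ n / (1 - q)).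
{ intros n t ht.
  apply (geometric_increments_limit (fun n => u n t)); auto.
  intros m; eapply Rle_trans; [apply (Hinc m t ht)|].
  unfold B; rewrite (Rmult_assoc eps), (Rmult_comm (q ^ m)), <- Rmult_assoc.
  apply Rmult_le_compat_r; [apply pow_le; lra|].
  apply Rmult_le_compat_l; auto; now apply exp_weight_le. }
exists y0.
assert (hy0 : continuous_on (Itv t0 r) y0).
{ apply continuous_on_uniform_limit; intros e he.
  assert (Hl := geometric_null (B / (1 - q)) q hq).
  apply is_lim_seq_spec in Hl.
  destruct (Hl (mkposreal e he)) as [N HN].
  specialize (HN N (Nat.le_refl N)); simpl in HN.
  exists (u N); split; auto; intros t ht.
  rewrite Rabs_minus_sym.
  eapply Rle_trans; [apply (Hlim N t ht)|].
  apply Rabs_def2 in HN.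
  replace (B * q ^ N / (1 - q)) with (B / (1 - q) * q ^ N) by (field; lra); lra. }
split; [split; auto|].
- intros t ht.
  change (y0 t = picard t0 f y0 t).
  apply Rminus_diag_uniq.
  (* The defect of [y0] is split through [u (S n)]: the weighted summand comes from contracting the
     distance of [u n] to [y0], the other from the distance of [u (S n)] to [y0]. *)
  apply geometric_bound_eq0 with (B * q / (1 - q) + B / (1 - q) * q * exp (eta * (t - t0))) q; auto.
  intros n.
  assert (H1 := Hlim (S n) t ht).
  assert (H2 : Rabs (u (S n) t - picard t0 f y0 t) <= B * q ^ n / (1 - q) * q * exp (eta * (t - t0))).
  { apply (picard_contraction (u n) y0); auto.
    intros s hs; eapply Rle_trans; [apply (Hlim n s hs)|].
    generalize (exp_weight_le s hs) (Rle_trans _ _ _ (Rabs_pos _) (Hlim n s hs)); nra. }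
  replace (y0 t - picard t0 f y0 t)
    with ((u (S n) t - picard t0 f y0 t) - (u (S n) t - y0 t)) by ring.
  eapply Rle_trans; [apply Rabs_triang|]; rewrite Rabs_Ropp.
  eapply Rle_trans; [apply Rplus_le_compat; [apply H2 | apply H1]|].
  right; simpl; field; lra.
- intros t ht.
  (* At [n = 0] the iterate is [y] itself, and the tail is the whole series [B / (1 - q)]. *)
  eapply Rle_trans; [apply (Hlim 0%nat t ht)|].
  right; simpl; unfold B; now rewrite Rmult_1_r.
Qed.

End Picard.

Theorem corollary2p5 (t0 r : R) (hr : 0 < r)
  (f : R * R -> R)
  (hf : continuous_on (fun p : R * R => Itv t0 r (fst p)) f)
  (L : R) (hL : 0 < L)
  (hLip : forall t y1 y2 : R, Itv t0 r t ->
     Rabs (f (t, y1) - f (t, y2)) <= L * Rabs (y1 - y2))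
  (eps : R) (heps : 0 <= eps) (eta : R) (heta : L < eta)
  (y : R -> R) (hyc : continuous_on (Itv t0 r) y)
  (hy : forall t : R, Itv t0 r t ->
     Rabs (y t - RInt (fun s => f (s, y s)) t0 t) <= eps) :
  exists y0 : R -> R,
    (volterra_solution t0 r f y0 /\
     forall t : R, Itv t0 r t ->
       Rabs (y t - y0 t) <= eps * exp (eta * r) / (1 - L / eta)) /\
    (forall z : R -> R,
       volterra_solution t0 r f z /\
       (forall t : R, Itv t0 r t ->
          Rabs (y t - z t) <= eps * exp (eta * r) / (1 - L / eta)) ->
       forall t : R, Itv t0 r t -> z t = y0 t).
Proof.
destruct (picard_fixed_point_near t0 r f hr hf L eta hL heta hLip y eps hyc hy) as [y0 [hy0 hyy0]].
exists y0; split; [now split|].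
intros z [hz hyz].
(* The factor 2 is the triangle inequality through [y]. *)
apply (picard_fixed_point_unique t0 r f hr hf L eta hL heta hLip z y0
  (2 * (eps * exp (eta * r) / (1 - L / eta))) hz hy0).
intros t ht.
replace (z t - y0 t) with ((y t - y0 t) - (y t - z t)) by ring.
eapply Rle_trans; [apply Rabs_triang|]; rewrite Rabs_Ropp.
generalize (hyz t ht) (hyy0 t ht); lra.
Qed.
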